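(* Let $\mu$ be a symmetric measure on $\mathbb{R}$ with finite moments, supported on a symmetric, infinite subset of $\mathbb{R}$, let $\{P_n(x)\}_{n=0}^{\infty}$ be the monic orthogonal polynomial sequence with respect to $\mu$, and let $c>0$ be a real number. Let $A_1:=c$ and let $A_n$ ($n\ge 2$) be real numbers such that the polynomials $$R_0(x,c):=1,\qquad R_n(x,c):=P_n(x)+A_{n-2}P_{n-2}(x)\quad (n\ge 3)$$ satisfy $$\int_{-\infty}^{\infty}R_0(x,c)R_n(x,c)\frac{d\mu(x)}{c+x^2}=0\ \ (n\ge 3),\qquad \int_{-\infty}^{\infty}R_3(x,c)R_n(x,c)\frac{d\mu(x)}{c+x^2}=0\ \ (n\ge 4).$$ Define $$R_2(x,c):=x^2-A_0(c),\qquad A_0(c):=\frac{\int_{-\infty}^{\infty}x^2\frac{d\mu(x)}{c+x^2}}{\int_{-\infty}^{\infty}\frac{d\mu(x)}{c+x^2}}.$$ Then $\{R_n(x,c)\}_{n\in\mathbb{N}\setminus\{1\}}$ is orthogonal with respect to $\frac{d\mu(x)}{c+x^2}$, i.e. there are constants $\mathcal{K}_n$ such that $$\int_{-\infty}^{\infty}R_n(x,c)R_m(x,c)\frac{d\mu(x)}{c+x^2}=\mathcal{K}_n\delta_{n,m},\qquad n,m=0,2,3,4,5,\dots$$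
   Context: $\mathbb{N}$ denotes the set of nonnegative integers. Measures are (non-negative) measures on $\mathbb{R}$; $\mu$ is symmetric if it is invariant under $x\mapsto -x$. A sequence of real polynomials $\{P_n(x)\}_{n=0}^{\infty}$ is an orthogonal polynomial sequence (OPS) with respect to $\mu$ if $\deg P_n=n$ for all $n\geq 0$, $\int P_nP_m\,d\mu=0$ for $n\ne m$, and $\int P_n^2\,d\mu\neq 0$ for all $n$. It is monic if every $P_n$ has leading coefficient $1$. $\delta_{n,m}$ is the Kronecker delta. *)

(* Defs.v *)
From HB Require Import structures.
From mathcomp Require Import all_boot all_order all_algebra.
From mathcomp Require Import all_classical all_reals all_analysis.
Import Order.TTheory GRing.Theory Num.Theory numFieldNormedType.Exports.

Set Implicit Arguments.
Unset Strict Implicit.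
Unset Printing Implicit Defensive.

Local Open Scope classical_set_scope.
Local Open Scope ring_scope.

Section Definitions.
Context {R : realType}.
Implicit Types (mu : {measure set (measurableTypeR R) -> \bar R}) (c : R).

Definition symmetric_measure mu : Prop :=
  forall E : set (measurableTypeR R), measurable E ->
    mu [set x : R | E (- x)] = mu E.

Definition finite_moments mu : Prop :=
  forall n : nat, mu.-integrable setT (fun x : R => (x ^+ n)%:E).

Definition measure_support mu : set R :=
  [set x | forall U : set R, open U -> U x -> (0 < mu U)%E].

Definition symmetric_set (E : set R) : Prop := forall x, E x -> E (- x).

(* [size p] is the degree plus one.  The integrals are [fine] parts of
   extended-real integrals; no infinite value is hidden when the moments are
   finite. *)
Definition is_OPS mu (P : nat -> {poly R}) : Prop :=
  [/\ forall n, size (P n) = n.+1,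
      forall n m, n != m -> \int[mu]_x ((P n).[x] * (P m).[x]) = 0
    & forall n, \int[mu]_x ((P n).[x] ^+ 2) != 0].

(* Integration against d mu(x) / (c + x^2); for c > 0 the weight is bounded,
   so f is integrable for it whenever f is mu-integrable. *)
Definition wint mu c (f : R -> R) : R := \int[mu]_x (f x / (c + x ^+ 2)).

Definition A0 mu c : R :=
  wint mu c (fun x => x ^+ 2) / wint mu c (fun=> 1).

End Definitions.

(* Main.v *)
(** Let [M] and [L] be integration of polynomials against [dmu] and
    [dmu / (c + x^2)], so that [L ((x^2 + c) s) = M s].  Divide [R_m] by
    [x^2 + c]: [R_m = (x^2 + c) s + a x + b].  For [m < n] the quotient has degree
    at most [n - 3], so [M (R_n s) = 0]; also [L R_n = 0], hence
    [L (R_n R_m) = a L (x R_n)].  Applied to [R_3], this turns the second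
    hypothesis into [a L (x R_n) = 0], where, because [A_1 = c], [a] is exactly
    the coefficient of [x] in [P_3].  That coefficient is nonzero: otherwise
    [0 = M (x P_3) = M (x^4)], the odd moments being zero.  Hence
    [L (x R_n) = 0] for [n >= 4]; the pairs with [n <= 3] are checked directly. *)
Require Import Defs.
From HB Require Import structures.
From mathcomp Require Import all_boot all_order all_algebra.
From mathcomp Require Import all_classical all_reals all_analysis.
From mathcomp Require Import measurable_realfun.
From mathcomp Require Import ring zify.
Import Order.TTheory GRing.Theory Num.Theory numFieldNormedType.Exports.
Local Open Scope classical_set_scope.
Local Open Scope ring_scope.

Set Implicit Arguments.
Unset Strict Implicit.

(** * Integration against a bounded weight as a linear functional on polynomials *)

(** Domination: [|p w|] is at most the sum of the [b |p_i| |x ^+ i|], each integrable by finiteness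
    of the moments. *)
Lemma integrable_horner_weight (R : realType)
    (mu : {measure set (measurableTypeR R) -> \bar R}) (w : R -> R) (b : R)
    (p : {poly R}) :
  finite_moments mu -> continuous w -> (forall x, `|w x| <= b) ->
  mu.-integrable setT (fun x : R => (p.[x] * w x)%:E).
Proof.
move=> mom cw wb.
have cp : continuous (fun x : R => p.[x] * w x).
  by move=> x; apply: cvgM; [exact: continuous_horner | exact: cw].
have int_sum : mu.-integrable setT
    (fun x : R => (\sum_(i < size p) (b * `|p`_i|)%:E * `|(x ^+ i)%:E|)%E).
  apply: integrable_sum => // i _; apply: integrableZl => //.
  exact: integrable_abse.
apply: le_integrable int_sum => //.
  by apply/measurable_EFinP; exact: continuous_measurable_fun.
move=> x _ /=; rewrite sumEFin lee_fin horner_coef.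
apply: le_trans (ler_norm _).
rewrite normrM mulrC.
apply: (@le_trans _ _ (b * \sum_(i < size p) `|p`_i * x ^+ i|)).
  apply: ler_pM => //; exact: ler_norm_sum.
by rewrite mulr_sumr; apply: ler_sum => i _; rewrite normrM mulrA lexx.
Qed.

(** Additivity of the integral needs the integrability above. Once it is packed into a linear form,
    the rest is algebra; the weights used are [1 / (c + x^2)] and [1]. *)
Lemma weighted_integral_functional (R : realType)
    (mu : {measure set (measurableTypeR R) -> \bar R}) (w : R -> R) (b : R) :
  finite_moments mu -> continuous w -> (forall x, `|w x| <= b) ->
  exists F : {scalar {poly R}}, forall p, F p = \int[mu]_x (p.[x] * w x).
Proof.
move=> mom cw wb.
have intw p := integrable_horner_weight p mom cw wb.
pose F (p : {poly R}) : R^o := \int[mu]_x (p.[x] * w x).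
have linF : linear F.
  move=> a p q; rewrite /F /GRing.scale /= -RintegralZl//; last exact: intw.
  rewrite -RintegralD//; last exact: intw.
    by apply: eq_Rintegral => x _; rewrite hornerD hornerZ mulrDl mulrA.
  rewrite (_ : EFin \o _ = fun x : R => ((a *: p).[x] * w x)%:E); last first.
    by apply/funext => x /=; rewrite hornerZ mulrA.
  exact: intw.
pose linF_mixin := GRing.isLinear.Build R {poly R} R^o *:%R F linF.
pose Fl : {scalar {poly R}} := HB.pack F linF_mixin.
by exists Fl.
Qed.

(** The reflection preserves [mu] and changes the sign of the integrand, so the moment equals its
    own opposite. *)
Lemma symmetric_odd_moment (R : realType)
    (mu : {measure set (measurableTypeR R) -> \bar R}) (n : nat) :
  symmetric_measure mu -> finite_moments mu -> odd n ->
  \int[mu]_x (x ^+ n) = 0.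
Proof.
move=> sym mom odd_n.
have push_opp (A : set (measurableTypeR R)) : measurable A -> A `<=` setT ->
    mu A = pushforward mu (-%R : measurableTypeR R -> measurableTypeR R) A.
  by move=> mA _; rewrite -sym.
have E : \int[mu]_x (x ^+ n) = \int[mu]_x (- (x ^+ n)).
  rewrite /Rintegral (eq_measure_integral _ push_opp) integral_pushforward //.
  - congr fine; apply: eq_integral => x _ /=.
    by rewrite exprNn -signr_odd odd_n mulN1r.
  - by apply/measurable_EFinP; exact: exprn_measurable.
  - rewrite preimage_setT (_ : _ \o _ = fun x : R => ((-1) ^+ n)%:E * (x ^+ n)%:E)%E.
      by apply: integrableZl => //; exact: mom.
    by apply/funext => x; rewrite -[RHS]EFinM -exprNn.
move: E; under [in RHS]eq_Rintegral do rewrite -mulN1r.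
rewrite RintegralZl //; last exact: mom.
by move=> E; apply/eqP; move/eqP: E; rewrite mulN1r -subr_eq0 opprK -mulr2n mulrn_eq0.
Qed.

(** * Positive functionals, orthogonality and division *)

(** The degenerate case of Cauchy-Schwarz: expand [F ((q - t p)^2)], whose [t^2] term vanishes. *)
Lemma scalar_square_eq0 (R : realType) (F : {scalar {poly R}}) (p q : {poly R}) :
  (forall r, 0 <= F (r ^+ 2)) -> F (p ^+ 2) = 0 -> F (p * q) = 0.
Proof.
move=> F_ge0 Fp0.
(* An affine function of [t] that is nonnegative everywhere is constant. *)
have H t : 0 <= F (q ^+ 2) - 2 * t * F (p * q).
  have expand : (q - t *: p) ^+ 2 =
      q ^+ 2 + (- (2 * t)) *: (p * q) + (t ^+ 2) *: p ^+ 2.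
    by rewrite -!mul_polyC rmorphN rmorphM rmorphXn /= rmorph_nat; ring.
  have := F_ge0 (q - t *: p).
  by rewrite expand !(linearD F) !(scalarZ F) Fp0 mulr0 addr0 mulNr.
apply/eqP/negP => /negP Fpq.
(* At this [t] the affine function takes the value [-1]. *)
have := H ((F (q ^+ 2) + 1) / (2 * F (p * q))).
rewrite (_ : _ - _ = -1) ?ler0N1 //; by field.
Qed.

(** Induction on a size bound [k <= n]: subtracting the multiple of a monic [P k] that cancels the
    top coefficient lowers the size and does not change [M (P n * s)]. *)
Lemma monic_orthogonal_lower (R : realType) (M : {scalar {poly R}})
    (P : nat -> {poly R}) :
  (forall n, P n \is monic) -> (forall n, size (P n) = n.+1) ->
  (forall n m, n != m -> M (P n * P m) = 0) ->
  forall n (s : {poly R}), (size s <= n)%N -> M (P n * s) = 0.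
Proof.
move=> Pm Ps Po n s; suff H k (r : {poly R}) : (k <= n)%N -> (size r <= k)%N -> M (P n * r) = 0.
  exact: (H n s).
elim: k r => {s} [|k IH] s kn.
  by rewrite leqn0 size_poly_eq0 => /eqP ->; rewrite mulr0 (linear0 M).
move=> ss.
rewrite -[X in P n * X](subrK (s`_k *: P k)).
rewrite mulrDr (linearD M) /= -scalerAr (scalarZ M) /= (Po n k) ?gtn_eqF // mulr0 addr0.
apply: IH; first exact: ltnW.
apply/leq_sizeP => j kj; rewrite coefB coefZ.
case: (ltngtP k j) kj => // [kj _|<- _].
  by rewrite (nth_default _ (leq_trans ss kj)) [(P k)`_j]nth_default ?mulr0 ?subr0 // Ps.
have := Pm k; rewrite monicE lead_coefE Ps /= => /eqP ->.
by rewrite mulr1 subrr.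
Qed.

Lemma divp_quadratic (R : fieldType) (c : R) (q : {poly R}) :
  exists s a b, q = ('X^2 + c%:P) * s + (a *: 'X + b%:P) /\
     (size s <= size q - 2)%N.
Proof.
have size_d : size ('X^2 + c%:P : {poly R}) = 3 by rewrite size_XnaddC.
have d0 : 'X^2 + c%:P != 0 :> {poly R} by rewrite -size_poly_eq0 size_d.
set d := 'X^2 + c%:P in size_d d0 *.
exists (q %/ d), ((q %% d)`_1), ((q %% d)`_0); split; last by rewrite size_divp // size_d.
rewrite {1}(divp_eq q d) mulrC; congr (_ + _).
have := ltn_modpN0 q d0; rewrite size_d ltnS.
move: (q %% d) => r size_r; apply/polyP => -[|[|i]].
- by rewrite !(coefD, coefZ, coefX, coefC) /= mulr0 add0r.
- by rewrite !(coefD, coefZ, coefX, coefC) /= mulr1 addr0.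
- by rewrite nth_default ?(leq_trans size_r) // !(coefD, coefZ, coefX, coefC) /= mulr0 addr0.
Qed.

(** If the coefficient vanished, [M (P 3 * 'X) = 0] would give [M 'X^4 = 0], hence [M 'X^2 = 0] by
    Cauchy-Schwarz against [1]. Writing [P 1 = 'X + b], orthogonality to [P 0] gives [b * M 1 = 0],
    and then [M (P 1 ^+ 2) = 0]. *)
Lemma third_coef1_neq0 (R : realType) (M : {scalar {poly R}})
    (P : nat -> {poly R}) :
  (forall r, 0 <= M (r ^+ 2)) -> M 'X = 0 -> M 'X^3 = 0 ->
  (forall n, P n \is monic) -> (forall n, size (P n) = n.+1) ->
  (forall n m, n != m -> M (P n * P m) = 0) -> M (P 1 ^+ 2) != 0 ->
  (P 3)`_1 != 0.
Proof.
move=> M_ge0 MX MX3 Pm Ps Po MP1; apply/eqP => P31.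
have lead n : (P n)`_n = 1 by have := Pm n; rewrite monicE lead_coefE Ps => /eqP.
have E0 : P 0 = 1.
  by rewrite -[P 0]coefK Ps poly_def big_ord1 lead expr0 scale1r.
have E1 : P 1 = 'X + ((P 1)`_0)%:P.
  rewrite -[LHS]coefK Ps poly_def !big_ord_recl big_ord0 /= /bump /= lead expr0 scale1r.
  by rewrite addr0 addrC alg_polyC.
have E3 : P 3 = 'X^3 + (P 3)`_2 *: 'X^2 + ((P 3)`_0)%:P.
  rewrite -[LHS]coefK Ps poly_def !big_ord_recl big_ord0 /= /bump /= lead P31 expr0.
  by rewrite scale1r scale0r add0r addr0 alg_polyC addrC [X in X + _]addrC.
have MX4 : M ('X^2 ^+ 2) = 0.
  have : M (P 3 * 'X) = 0.
    by apply: (monic_orthogonal_lower Pm Ps Po); rewrite size_polyX.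
  have -> : P 3 * 'X = 'X^2 ^+ 2 + (P 3)`_2 *: 'X^3 + (P 3)`_0 *: 'X.
    by rewrite [in LHS]E3 -!mul_polyC; ring.
  by rewrite !(linearD M) !(scalarZ M) MX MX3 !mulr0 !addr0.
have MX2 : M ('X^2) = 0 by rewrite -['X^2]mulr1 scalar_square_eq0.
have bM1 : (P 1)`_0 * M 1 = 0.
  have := Po 1 0 isT; rewrite E0 mulr1 E1 -alg_polyC (linearD M) (scalarZ M) MX.
  by rewrite alg_polyC -E1 add0r.
move/eqP: MP1; apply.
have -> : P 1 ^+ 2 = 'X^2 + (2 * (P 1)`_0) *: 'X + (P 1)`_0 *: ((P 1)`_0 *: 1).
  by rewrite [in LHS]E1 -!mul_polyC rmorphM rmorph_nat; ring.
by rewrite !(linearD M) !(scalarZ M) MX2 MX bM1 !mulr0 !addr0.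
Qed.

(** * The algebraic core: orthogonality from two linear functionals *)

Lemma exceptional_orthogonality (R : realType) (M L : {scalar {poly R}})
    (P Q : nat -> {poly R}) (c : R) (A : nat -> R) :
  (forall p, L (('X^2 + c%:P) * p) = M p) ->
  (forall r, 0 <= M (r ^+ 2)) -> (forall r, 0 <= L (r ^+ 2)) ->
  M 'X = 0 -> M 'X^3 = 0 ->
  (forall n, P n \is monic) -> (forall n, size (P n) = n.+1) ->
  (forall n m, n != m -> M (P n * P m) = 0) -> (forall n, M (P n ^+ 2) != 0) ->
  A 1 = c -> Q 0 = 1 -> Q 2 = 'X^2 - (L 'X^2 / L 1)%:P ->
  (forall n, (3 <= n)%N -> Q n = P n + A (n - 2)%N *: P (n - 2)%N) ->
  (forall n, (3 <= n)%N -> L (Q n) = 0) ->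
  (forall n, (4 <= n)%N -> L (Q 3 * Q n) = 0) ->
  forall n m, (m < n)%N -> n != 1%N -> m != 1%N -> L (Q n * Q m) = 0.
Proof.
move=> LM M_ge0 L_ge0 MX MX3 Pm Ps Po Pnz A1 Q0 Q2 QE orth0 orth3.
have lead n : (P n)`_n = 1 by have := Pm n; rewrite monicE lead_coefE Ps => /eqP.
have sizeQ n : n != 1%N -> (size (Q n) <= n.+1)%N.
  case: n => [_|[//|[_|n _]]]; first by rewrite Q0 size_poly1.
    by rewrite Q2 size_XnsubC.
  rewrite QE // (leq_trans (size_polyD _ _)) // geq_max Ps leqnn /=.
  by rewrite (leq_trans (size_scale_leq _ _)) // Ps; lia.
have MQ n (s : {poly R}) : (3 <= n)%N -> (size s <= n - 2)%N -> M (Q n * s) = 0.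
  move=> n3 ss; rewrite QE // mulrDl -scalerAl (linearD M) (scalarZ M).
  by rewrite !(monic_orthogonal_lower Pm Ps Po) ?mulr0 ?addr0 //; lia.
(* The factor ['X^2 + c] turns [L] into [M], which kills the quotient; [L (Q n) = 0] kills [b]. *)
have LQ n (s : {poly R}) a b : (3 <= n)%N -> (size s <= n - 2)%N ->
    L (Q n * (('X^2 + c%:P) * s + (a *: 'X + b%:P))) = a * L (Q n * 'X).
  move=> n3 ss.
  rewrite mulrDr mulrCA (linearD L) LM MQ // add0r mulrDr -scalerAr.
  rewrite [Q n * _%:P]mulrC mul_polyC (linearD L) !(scalarZ L) orth0 //.
  by rewrite mulr0 addr0.
have LXQ n : (4 <= n)%N -> L (Q n * 'X) = 0.
  move=> n4; have [s [a [b [E3 ss]]]] := divp_quadratic c (Q 3).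
  have {}ss : (size s <= 2)%N
    by rewrite (leq_trans ss) // (leq_sub2r 2 (sizeQ 3%N isT)).
  have := orth3 n n4; rewrite mulrC [in X in _ * X]E3.
  rewrite (LQ _ _ _ _ (ltnW n4) (leq_trans ss (leq_sub2r 2 n4))).
  move/eqP; rewrite mulf_eq0 => /orP[/eqP a0|/eqP //].
  (* With [a = 0], the coefficients of degree 3 and 1 give [(Q 3)_1 = c], as [Q 3] is monic. But
     [Q 3 = P 3 + c P 1] gives [(Q 3)_1 = (P 3)_1 + c], so [(P 3)_1] would be zero. *)
  have s1 : s`_1 = (Q 3)`_3.
    rewrite E3 mulrDl mul_polyC !(coefD, coefZ, coefX, coefC, coefXnM) /=.
    by rewrite (nth_default _ (_ : size s <= 3)%N) ?(leq_trans ss) // !mulr0 !addr0.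
  have := third_coef1_neq0 M_ge0 MX MX3 Pm Ps Po (Pnz 1).
  have : (Q 3)`_1 = c * s`_1.
    rewrite E3 a0 mulrDl mul_polyC !(coefD, coefZ, coefX, coefC, coefXnM) /=.
    by rewrite mul0r !addr0 add0r.
  rewrite s1 QE // !coefD !coefZ lead A1 (nth_default _ (_ : size (P 1) <= 3)%N) ?Ps //.
  rewrite lead mulr0 addr0 mulr1 => P31.
  by rewrite -(addrK c (P 3)`_1) P31 subrr eqxx.
(* This makes the quotient defining [Q 2] genuine. If [L 1 = 0], Cauchy-Schwarz gives [L 'X^2 = 0],
   so [M (P 0 ^+ 2) = L ('X^2 + c) = 0]. *)
have L1 : L 1 != 0.
  apply/eqP => L10; have E0 : P 0 = 1.
    by rewrite -[P 0]coefK Ps poly_def big_ord1 lead expr0 scale1r.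
  have /eqP := Pnz 0; apply; rewrite E0 expr1n -LM mulr1 (linearD L) -alg_polyC (scalarZ L).
  by rewrite L10 mulr0 addr0 -['X^2]mul1r scalar_square_eq0 // expr1n.
case=> [//|[//|[|n]]] m mn _ m1.
  have -> : m = 0 by move: mn m1; case: m => [|[]].
  rewrite Q0 mulr1 Q2 (linearB L) -alg_polyC (scalarZ L) divfK ?subrr //.
have [s [a [b [Em ss]]]] := divp_quadratic c (Q m).
(* The larger index is now [n.+3]. [LXQ] covers [n != 0]; [Q 3] is left to be paired with [Q 0] and
   [Q 2]. *)
have := sizeQ m m1; have [n0 _|n0] := eqVneq n 0%N; last first.
  move=> sm; rewrite Em LQ ?LXQ ?mulr0 // ?ltnS ?lt0n //.
  exact: leq_trans ss (leq_sub2r 2 (leq_trans sm mn)).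
have {}mn : m = 0%N \/ m = 2%N.
  by move: mn m1; rewrite n0; case: m {Em ss} => [|[|[|]]] //; [left|right].
rewrite n0; case: mn => ->; first by rewrite Q0 mulr1 orth0.
(* [Q 2] is ['X^2 + c] minus a constant, so [M (Q 3) = 0] and [L (Q 3) = 0] suffice. *)
have -> : Q 3 * Q 2 =
    ('X^2 + c%:P) * (Q 3 * 1) - (c + L 'X^2 / L 1) *: Q 3.
  by rewrite Q2 -mul_polyC rmorphD; ring.
by rewrite (linearB L) (scalarZ L) LM MQ ?size_poly1 // orth0 // mulr0 subr0.
Qed.

(** * Transfer to the measure *)

Unset Implicit Arguments.
Set Strict Implicit.

Theorem theorem3p4 (R : realType)
    (mu : {measure set (measurableTypeR R) -> \bar R})
    (mu_sym : symmetric_measure mu)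
    (mu_mom : finite_moments mu)
    (supp_sym : symmetric_set (measure_support mu))
    (supp_inf : infinite_set (measure_support mu))
    (P : nat -> {poly R})
    (P_ops : is_OPS mu P)
    (P_monic : forall n : nat, P n \is monic)
    (c : R) (c_gt0 : 0 < c)
    (A : nat -> R) (A1 : A 1%N = c)
    (Rc : nat -> {poly R})
    (Rc0 : Rc 0%N = 1)
    (Rc2 : Rc 2%N = 'X^2 - (A0 mu c)%:P)
    (RcE : forall n : nat, (3 <= n)%N ->
       Rc n = P n + A (n - 2)%N *: P (n - 2)%N)
    (orth0 : forall n : nat, (3 <= n)%N ->
       wint mu c (fun x => (Rc 0%N).[x] * (Rc n).[x]) = 0)
    (orth3 : forall n : nat, (4 <= n)%N ->
       wint mu c (fun x => (Rc 3%N).[x] * (Rc n).[x]) = 0) :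
  exists K : nat -> R, forall n m : nat, n != 1%N -> m != 1%N ->
    wint mu c (fun x => (Rc n).[x] * (Rc m).[x]) = K n * (n == m)%:R.
Proof.
have den_gt0 (x : R) : 0 < c + x ^+ 2 by rewrite ltr_wpDr // sqr_ge0.
have cont_w : continuous (fun x : R => (c + x ^+ 2)^-1).
  move=> x; apply: cvgV; first exact: lt0r_neq0.
  by apply: cvgD; [exact: cvg_cst | exact: exprn_continuous].
have w_bounded (x : R) : `|(c + x ^+ 2)^-1| <= c^-1.
  by rewrite gtr0_norm ?invr_gt0 // lef_pV2 ?posrE // lerDl sqr_ge0.
have [L LE] := weighted_integral_functional mu_mom cont_w w_bounded.
have [M ME'] : exists M : {scalar {poly R}}, forall p, M p = \int[mu]_x (p.[x] * 1).
  apply: (@weighted_integral_functional _ _ (fun=> 1) 1 mu_mom).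
    by move=> x; exact: cvg_cst.
  by move=> x; rewrite normr1.
have ME p : M p = \int[mu]_x p.[x].
  by rewrite ME'; apply: eq_Rintegral => x _; rewrite mulr1.
have wintE p q : wint mu c (fun x => p.[x] * q.[x]) = L (p * q).
  by rewrite LE; apply: eq_Rintegral => x _; rewrite hornerM.
have [sizeP orthP nzP] := P_ops.
have orth := @exceptional_orthogonality R M L P Rc c A.
(* The constants are the squared norms, so only [n != m] remains, and commutativity reduces it to
   one order. *)
exists (fun n => L (Rc n * Rc n)) => n m n1 m1; rewrite wintE.
have {}orth k l : (l < k)%N -> k != 1%N -> l != 1%N -> L (Rc k * Rc l) = 0.
  apply: orth => //.
  - move=> p; rewrite LE ME; apply: eq_Rintegral => x _.
    by rewrite !hornerE mulrAC [X in X / _]addrC divff ?mul1r // lt0r_neq0.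
  - by move=> r; rewrite ME; apply: Rintegral_ge0 => x _; rewrite horner_exp sqr_ge0.
  - move=> r; rewrite LE; apply: Rintegral_ge0 => x _.
    by rewrite horner_exp divr_ge0 ?sqr_ge0 // ltW.
  - rewrite ME -(symmetric_odd_moment (n := 1) mu_sym mu_mom) //.
    by apply: eq_Rintegral => x _; rewrite hornerX.
  - rewrite ME -(symmetric_odd_moment (n := 3) mu_sym mu_mom) //.
    by apply: eq_Rintegral => x _; rewrite hornerXn.
  - move=> i j ij; rewrite ME -(orthP _ _ ij).
    by apply: eq_Rintegral => x _; rewrite hornerM.
  - move=> i; rewrite ME (_ : \int[mu]_x _ = \int[mu]_x ((P i).[x] ^+ 2)) //.
    by apply: eq_Rintegral => x _; rewrite horner_exp.
  - rewrite Rc2 /A0; congr (_ - (_ / _)%:P).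
      by rewrite LE; apply: eq_Rintegral => x _; rewrite hornerXn.
    by rewrite LE; apply: eq_Rintegral => x _; rewrite hornerC.
  - by move=> i i3; rewrite -(orth0 i i3) wintE Rc0 mul1r.
  - by move=> i i4; rewrite -wintE orth3.
have [->|nm] := eqVneq n m; first by rewrite mulr1.
rewrite mulr0; case: (ltngtP n m) nm => // [lt_nm|lt_mn] _; last exact: orth.
by rewrite mulrC orth.
Qed.
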